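(* Let $\pi:(X,T)\to(Y,T)$ be a factor map of systems and let $d\ge1$ be an integer. Then: (1) $(\pi\times\pi)(\mathbf{RP}^{[d]}(X))\subseteq\mathbf{RP}^{[d]}(Y)$; (2) if $(X,T)$ is minimal, then $(\pi\times\pi)(\mathbf{RP}^{[d]}(X))=\mathbf{RP}^{[d]}(Y)$.
   Context: A system $(X,T)$ is a compact metric space $X$ with a homeomorphism $T:X\to X$ (the same letter $T$ is used for the homeomorphism of every system); it is minimal if every orbit $\{T^nx:n\in\mathbb Z\}$ is dense. A factor map $\pi:(X,T)\to(Y,T)$ is a continuous surjection $X\to Y$ with $\pi\circ T=T\circ\pi$. For a system $(X,T)$ with metric $\rho$, $\mathbf{RP}^{[d]}(X)$ (regionally proximal relation of order $d$) is the set of $(x,y)\in X\times X$ such that for every $\delta>0$ there are $x',y'\in X$ and $\mathbf n=(n_1,\dots,n_d)\in\mathbb Z^d$ with $\rho(x,x')<\delta$, $\rho(y,y')<\delta$ and $\rho(T^{\mathbf n\cdot\epsilon}x',T^{\mathbf n\cdot\epsilon}y')<\delta$ for all $\epsilon\in\{0,1\}^d\setminus\{(0,\dots,0)\}$, where $\mathbf n\cdot\epsilon=\sum_i n_i\epsilon_i$. *)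

(* Defs.v *)
From HB Require Import structures.
From mathcomp Require Import all_boot all_order all_algebra.
From mathcomp Require Import all_classical all_reals all_analysis.

Set Implicit Arguments.
Unset Strict Implicit.
Unset Printing Implicit Defensive.

Import Order.TTheory GRing.Theory Num.Theory.
Import numFieldNormedType.Exports.

Local Open Scope classical_set_scope.
Local Open Scope ring_scope.

(* The inverse of the homeomorphism is kept as a field so that negative
   iterates can be written down; it is determined by [homeo]. *)
Record system (R : realType) := System {
  space :> metricType R;
  homeo : space -> space;
  homeo_inv : space -> space;
  homeoK : cancel homeo homeo_inv;
  homeo_invK : cancel homeo_inv homeo;
  homeo_continuous : continuous homeo;
  homeo_inv_continuous : continuous homeo_inv;
  space_compact : compact [set: space]
}.

(* [Negz k] is the integer - (k + 1). *)
Definition iterz (R : realType) (X : system R) (n : int) : X -> X :=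
  match n with
  | Posz k => iter k (@homeo R X)
  | Negz k => iter k.+1 (@homeo_inv R X)
  end.

Definition orbitz (R : realType) (X : system R) (x : X) : set X :=
  range (fun n : int => iterz n x).

Definition minimal_system (R : realType) (X : system R) : Prop :=
  forall x : X, dense (orbitz x).

Definition factor_map (R : realType) (X Y : system R) (pi : X -> Y) : Prop :=
  [/\ continuous pi,
      set_surj [set: X] [set: Y] pi
    & forall x : X, pi (homeo x) = homeo (pi x)].

Definition cube_dot (d : nat) (n : {ffun 'I_d -> int})
    (eps : {ffun 'I_d -> bool}) : int :=
  \sum_(i < d) n i * (eps i)%:R.

Definition RP (R : realType) (d : nat) (X : system R) : set (X * X) :=
  [set p | forall delta : R, 0 < delta ->
     exists (x' y' : X) (n : {ffun 'I_d -> int}),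
       [/\ mdist p.1 x' < delta,
           mdist p.2 y' < delta
         & forall eps : {ffun 'I_d -> bool}, eps != [ffun=> false] ->
             mdist (iterz (cube_dot n eps) x')
                   (iterz (cube_dot n eps) y') < delta]].

Arguments RP {R} d X _.

Definition map_prod (S T : Type) (f : S -> T) (p : S * S) : T * T :=
  (f p.1, f p.2).

(* Main.v *)
Require Import Defs.
From HB Require Import structures.
From mathcomp Require Import all_boot all_order all_algebra.
From mathcomp Require Import all_classical all_reals all_analysis.
From mathcomp Require Import lra.

Set Implicit Arguments.
Unset Strict Implicit.
Unset Printing Implicit Defensive.

Import Order.TTheory GRing.Theory Num.Theory.

Local Open Scope classical_set_scope.
Local Open Scope ring_scope.

(* (2) is proved with the Ellis semigroup [ellis Phi] of pointwise limits of cube transformations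
   [T^(m + n.eps)] on [X].  Let [u] be an idempotent of a minimal left ideal [L] with [u x = x].
   Every limit [p] can be brought back to the diagonal: some limit [q] satisfies
   [q_eps (p_eps x) = x] for all vertices [eps].  Start from [(y1, y2)] regionally proximal, lifts
   [b1, b2] and idempotents [u, v] of [L] with [u b1 = b1], [v b2 = b2], and put [c = u b2].  The
   pair [(pi c, y1)] is regionally proximal, so its cube in [Y] lifts to a cube [p_eps c].  Bringing
   faces back to the diagonal, and reflecting the cube in between, yields a cube equal to [c] except
   at one vertex [z].  The pair [(c, z)] then lies above a limit of translates of the minimal point
   [(pi c, y1)], so a further limit [t] takes it to [(t c, t z)] above [(pi c, y1)].  Reflecting again
   and applying [v] off the origin gives the cube [(t z, v t c, ..., v t c)], whose only two values
   are a regionally proximal pair; it lies above [(y1, y2)] because [v u = v]. *)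

(** * Compact right topological semigroups *)

(** [Zorn_bigcup] handles unions of chains, so it is applied to complements of closed sets meeting
    [K]. Keeping [H] abstract covers both subsemigroups and left ideals. *)
Lemma exists_minimal_closed (T : topologicalType) (K : set T)
    (H : set T -> Prop) :
  compact K -> closed K -> K !=set0 -> H K ->
  (forall F : set (set T), F `<=` H -> H (\bigcap_(A in F) A)) ->
  exists M, [/\ M `<=` K, closed M, M !=set0, H M &
    forall N, N `<=` M -> closed N -> N !=set0 -> H N -> N = M].
Proof.
move=> Kco Kcl K0 HK Hcap.
pose good A := [/\ closed A, K `&` A !=set0 & H A].
have HI A B : H A -> H B -> H (A `&` B).
  move=> HA HB; have := Hcap [set A; B].
  by rewrite bigcap_setU !bigcap_set1; apply => C [|] ->.
have [F Fgood Ftot|U [[Ucl U0 HU] Umax]] :=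
    @Zorn_bigcup T [set U | good (~` U)].
  rewrite /= setC_bigcup; split.
  - by apply: closed_bigI => U /Fgood[].
  - have [[U0 FU0]|F0] := pselect (F !=set0); last first.
      by case: K0 => x Kx; exists x; split=> // U FU; case: F0; exists U.
    pose G := filter_from F (fun U => K `&` ~` U).
    have PG : ProperFilter G.
      apply: filter_from_proper; last by move=> U /Fgood[].
      apply: filter_from_filter; first by exists U0.
      move=> U V FU FV; have [UV|VU] := Ftot _ _ FU FV.
        by exists V => // x [Kx Vx]; do 2 split => //; move=> /UV.
      by exists U => // x [Kx Ux]; do 2 split => //; move=> /VU.
    have [|x [Kx clx]] := Kco G PG; first by exists U0 => // x [].
    exists x; split=> // U FU; have [Ucl _ _] := Fgood _ FU.
    by apply: Ucl => B; apply: clx; exists U => // y [].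
  - have := Hcap [set ~` U | U in F]; rewrite bigcap_image; apply.
    by move=> _ [U /Fgood[_ _ HU] <-].
exists (K `&` ~` U); split => //; first exact: closedI.
  exact: HI.
move=> N NK Ncl N0 HN; apply/seteqP; split=> // x [Kx Ux].
apply: contrapT => Nx; apply: (Umax (~` N)).
  by split=> [y Uy /NK[]//|/(_ x Nx)].
by rewrite /= setCK; split=> //; case: N0 => y Ny; exists y; split=> //;
  case: (NK _ Ny).
Qed.

Section RightTopologicalSemigroup.
Variables (T : topologicalType) (op : T -> T -> T).
Hypothesis hausT : hausdorff_space T.
Hypothesis opA : associative op.
Hypothesis op_continuous : forall q, continuous (op^~ q).

Definition subsemigroup (K : set T) := forall p q, K p -> K q -> K (op p q).

Lemma closed_op_image (K : set T) (q : T) :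
  compact K -> closed K -> closed (op^~ q @` K).
Proof.
move=> Kco Kcl; apply: compact_closed => //.
by apply: continuous_compact => //; exact: continuous_subspaceT.
Qed.

(** In a minimal closed subsemigroup [M], minimality gives [M s = M], so some [p] in [M] has
    [p s = s]. All such [p] form a closed subsemigroup, hence all of [M], which contains [s]. *)
Theorem ellis_numakura (K : set T) : compact K -> closed K -> K !=set0 ->
  subsemigroup K -> exists2 e, K e & op e e = e.
Proof.
move=> Kco Kcl K0 Ksg.
have [F Fsg p q Fp Fq A FA|M [MK Mcl [s Ms] Msg Mmin]] :=
    @exists_minimal_closed T K subsemigroup Kco Kcl K0 Ksg.
  by apply: (Fsg _ FA); [exact: Fp|exact: Fq].
have Mco : compact M := subclosed_compact Mcl Kco MK.
have eMs : op^~ s @` M = M.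
  apply: Mmin.
  - by move=> _ [p Mp <-]; exact: Msg.
  - exact: closed_op_image.
  - by exists (op s s), s.
  - move=> _ _ [p Mp <-] [q Mq <-]; exists (op (op p s) q); rewrite -?opA//.
    by do 2 apply: (Msg) => //.
exists s; first exact: MK.
pose N := M `&` [set p | op p s = s].
have eN : N = M.
  apply: Mmin.
  - by move=> p [].
  - apply: closedI => //.
    have /continuous_closedP/(_ [set s]) := @op_continuous s; apply.
    exact/accessible_closed_set1/hausdorff_accessible.
  - by have := Ms; rewrite -{1}eMs => -[p Mp pss]; exists p.
  - by move=> p q [Mp ps] [Mq qs]; split; [exact: Msg|rewrite /= -opA qs].
by have [] : N s by rewrite eN.
Qed.

Definition left_ideal (E L : set T) :=
  L !=set0 /\ forall p q, E p -> L q -> L (op p q).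

(* Minimality of a left ideal in this form: it is generated by each of its elements. *)
Lemma exists_minimal_left_ideal (E : set T) : compact E -> closed E ->
  E !=set0 -> subsemigroup E -> exists L : set T,
  [/\ L `<=` E, closed L, left_ideal E L &
    forall p q, L p -> L q -> exists2 a, E a & op a p = q].
Proof.
move=> Eco Ecl E0 Esg.
pose H L := forall p q, E p -> L q -> L (op p q).
have [F FH p q Ep Fq A FA|L [LE Lcl L0 LH Lmin]] :=
    @exists_minimal_closed T E H Eco Ecl E0 Esg.
  by apply: (FH _ FA) => //; exact: Fq.
exists L; split=> // p q Lp Lq.
have eL : op^~ p @` E = L.
  apply: Lmin.
  - by move=> _ [a Ea <-]; exact: LH.
  - exact: closed_op_image.
  - by case: E0 => a Ea; exists (op a p), a.
  - move=> a _ Ea [b Eb <-]; exists (op a b); rewrite ?opA//.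
    exact: Esg.
by move: Lq; rewrite -eL => -[a Ea <-]; exists a.
Qed.

Lemma idempotent_right_unit (E L : set T) (p v : T) :
  (forall p q, L p -> L q -> exists2 a, E a & op a p = q) ->
  L p -> L v -> op v v = v -> op p v = p.
Proof. by move=> Lmin Lp Lv vv; have [a _ <-] := Lmin _ _ Lv Lp; rewrite -opA vv. Qed.

End RightTopologicalSemigroup.

Lemma continuous_to_prod (T : topologicalType) (C : eqType)
    (U : C -> topologicalType) (f : T -> prod_topology U) :
  (forall c, continuous (fun t => f t c)) -> continuous f.
Proof.
move=> fc x; apply/cvg_sup => c; move: x.
apply/(@continuousP _ (initial_topology (fun g : prod_topology U => g c))).
move=> A [B oB <-]; have -> : f @^-1` ((fun g => g c) @^-1` B) =
  (fun t => f t c) @^-1` B by [].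
by apply: open_comp => // t _; exact: fc.
Qed.

(** * Ellis sets of a system *)

Section Iterates.
Variables (R : realType) (X : system R).
Implicit Types (m n : int) (x : X).

Lemma iterzS n x : iterz (n + 1) x = homeo (iterz n x).
Proof.
case: n => [k|[|k]]; first by rewrite -PoszD addn1.
  by rewrite /= homeo_invK.
have -> : Negz k.+1 + 1 = Negz k by rewrite !NegzE -[in LHS]addn1 PoszD opprD addrNK.
by rewrite /= homeo_invK.
Qed.

Lemma iterzB1 n x : iterz (n - 1) x = homeo_inv (iterz n x).
Proof. by rewrite -{2}[n](subrK 1) iterzS homeoK. Qed.

Lemma iterzD m n x : iterz (m + n) x = iterz m (iterz n x).
Proof.
elim/int_rect: m => [|k IHk|k IHk]; first by rewrite add0r.
  by rewrite -addn1 PoszD addrAC !iterzS IHk.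
by rewrite -addn1 PoszD opprD addrAC !iterzB1 IHk.
Qed.

Lemma iterz_continuous n : continuous (@iterz R X n).
Proof.
have iter_cont (f : X -> X) k : continuous f -> continuous (iter k f).
  move=> fc; elim: k => [|k IHk] x; first exact: cvg_id.
  by apply: continuous_comp; [exact: IHk|exact: fc].
by case: n => k; apply: iter_cont; [exact: homeo_continuous|exact: homeo_inv_continuous].
Qed.

End Iterates.

Lemma factor_iterz (R : realType) (X Y : system R) (pi : X -> Y) (n : int)
  (x : X) : factor_map pi -> pi (iterz n x) = iterz n (pi x).
Proof.
case=> _ _ piT; have piTinv z : pi (homeo_inv z) = homeo_inv (pi z).
  by rewrite -[in RHS](homeo_invK z) piT homeoK.
by case: n => k /=; [|rewrite piTinv; congr homeo_inv]; elim: k => //= k <-.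
Qed.

(** * Metric estimates for finite families of continuous maps *)

Lemma continuous_mdist (R : realType) (U V : metricType R) (f : U -> V) (x : U)
    (e : R) : {for x, continuous f} -> 0 < e ->
  exists2 d : R, 0 < d & forall y, mdist x y < d -> mdist (f x) (f y) < e.
Proof.
move=> /metricType_numDomainType.cvgrPdist_lt fx e0.
have /metricType_numDomainType.nbhs_mdistP[d d0 dP] := fx e e0.
by exists d.
Qed.

Lemma mdist_midpoint (R : realType) (U : metricType R) (x y z : U) (e : R) :
  mdist y x < e / 2 -> mdist y z < e / 2 -> mdist x z < e.
Proof.
move=> yx yz; rewrite (splitr e); apply: le_lt_trans (metric_triangle x y z) _.
by rewrite metric_sym ltrD.
Qed.

Lemma mdist_eq0P (R : realType) (U : metricType R) (x y : U) :
  (forall e : R, 0 < e -> mdist x y < e) -> x = y.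
Proof.
move=> xy; apply: contrapT => /eqP; rewrite -mdist_gt0 => /xy.
by rewrite ltxx.
Qed.

Lemma uniform_radius (R : realType) (T : eqType) (s : seq T)
    (P : T -> R -> Prop) :
  (forall t d d', P t d -> d' <= d -> P t d') ->
  (forall t, exists2 d, 0 < d & P t d) ->
  exists2 d, 0 < d & forall t, t \in s -> P t d.
Proof.
move=> Pdown Pex; elim: s => [|t s [d d0 dP]]; first by exists 1.
have [d' d'0 Ptd'] := Pex t; exists (Num.min d d').
  by rewrite lt_min d0.
move=> t'; rewrite inE => /predU1P[->|/dP Pd].
  by apply: Pdown Ptd' _; rewrite ge_min lexx orbT.
by apply: Pdown Pd _; rewrite ge_min lexx.
Qed.

Lemma continuous_mdist_seq (R : realType) (T : eqType) (U V : metricType R)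
    (s : seq T) (f : T -> U -> V) (x : T -> U) (e : R) :
  (forall t, continuous (f t)) -> 0 < e ->
  exists2 d : R, 0 < d & forall t, t \in s -> forall y, mdist (x t) y < d ->
    mdist (f t (x t)) (f t y) < e.
Proof.
move=> fc e0; apply: uniform_radius => [t d d' Pd d'd y /lt_le_trans|t].
  by move=> /(_ _ d'd); exact: Pd.
exact: continuous_mdist (fc t (x t)) e0.
Qed.

Section EllisSet.
Variables (R : realType) (X : system R).

(** Families of self-maps of [X] indexed by [I], under pointwise convergence. Uncurried, they form a
    single product, compact by Tychonoff. *)
Definition fiber_maps (I : eqType) :=
  prod_topology (fun _ : I * X => X : topologicalType).

Definition fcomp (I : eqType) (p q : fiber_maps I) : fiber_maps I :=
  fun c => p (c.1, q c).

(* The pointwise closure of the maps [(i, x) |-> T^(f i) x] with [f] in [Phi]. *)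
Definition ellis (I : eqType) (Phi : set (I -> int)) : set (fiber_maps I) :=
  [set p | forall (s : seq (I * X)) (e : R), 0 < e -> exists2 f, Phi f &
    forall c, c \in s -> mdist (p c) (iterz (f c.1) c.2) < e].

Lemma fcompA (I : eqType) : associative (@fcomp I).
Proof. by []. Qed.

Lemma fcomp_continuous (I : eqType) (q : fiber_maps I) :
  continuous ((@fcomp I)^~ q).
Proof.
apply: continuous_to_prod => c.
exact: (@proj_continuous _ (fun _ : I * X => X : topologicalType) (c.1, q c)).
Qed.

Lemma fiber_maps_hausdorff (I : eqType) : hausdorff_space (fiber_maps I).
Proof. by apply: hausdorff_product => _; exact: metric_hausdorff. Qed.

Lemma nbhs_fiber_maps (I : eqType) (p : fiber_maps I) (s : seq (I * X)) (e : R) :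
  0 < e -> nbhs p [set q : fiber_maps I | forall c, c \in s -> mdist (p c) (q c) < e].
Proof.
move=> e0; have FF : Filter (nbhs p) := nbhs_filter p.
elim: s => [|c s IHs]; first exact: filterS filterT.
have pc := @proj_continuous _ (fun _ : I * X => X : topologicalType) c p.
have /metricType_numDomainType.cvgrPdist_lt/(_ e e0) pce := pc.
apply: filterS (filterI pce IHs) => q [qc qs] c'.
by rewrite inE => /predU1P[->|/qs].
Qed.

Lemma fiber_maps_compact (I : eqType) : compact [set: fiber_maps I].
Proof.
have := @tychonoff _ (fun _ : I * X => X : topologicalType) (fun=> setT).
move=> /(_ (fun=> @space_compact R X)); congr compact.
by apply/seteqP; split.
Qed.

Section Exponents.
Variables (I : eqType) (Phi : set (I -> int)).

Lemma ellis_closed : closed (ellis Phi).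
Proof.
move=> p clp s e e0; have e20 : 0 < e / 2 by rewrite divr_gt0.
have [q [Eq pq]] := clp _ (nbhs_fiber_maps p s e20).
have [f Phif fq] := Eq s _ e20; exists f => // c cs.
by apply: mdist_midpoint (fq c cs); rewrite metric_sym; exact: pq.
Qed.

Lemma ellis_compact : compact (ellis Phi).
Proof. exact: subclosed_compact ellis_closed (@fiber_maps_compact I) _. Qed.

(** The product need not be sequentially compact, so a cluster point replaces the limit of a
    subsequence: each finite set of coordinates is approximated at arbitrarily late [k]. *)
Lemma ellis_cluster (g : nat -> I -> int) : (forall k, Phi (g k)) ->
  exists2 p, ellis Phi p & forall (s : seq (I * X)) (e : R) (k0 : nat), 0 < e ->
    exists2 k, (k0 <= k)%N &
      forall c, c \in s -> mdist (p c) (iterz (g k c.1) c.2) < e.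
Proof.
move=> Phig; pose h k : fiber_maps I := fun c => iterz (g k c.1) c.2.
have [|p [_ clp]] := @fiber_maps_compact I (h @ \oo) _; first exact: filterT.
have hp (s : seq (I * X)) (e : R) (k0 : nat) : 0 < e -> exists2 k, (k0 <= k)%N &
    forall c, c \in s -> mdist (p c) (iterz (g k c.1) c.2) < e.
  move=> e0; have [|_ [[k k0k <-] hs]] := clp (h @` [set k | (k0 <= k)%N]) _ _
    (nbhs_fiber_maps p s e0).
    by exists k0 => // k k0k; exists k.
  by exists k.
exists p => // s e e0; have [k _ ks] := hp s e 0%N e0.
by exists (g k).
Qed.

(** Two-stage approximation: first [T^f] approximates [p] at the points [q c], then [T^g]
    approximates [q] as closely as the continuity of that fixed [T^f] requires. *)
Lemma ellis_subsemigroup :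
  (forall f g, Phi f -> Phi g -> Phi (fun i => f i + g i)) ->
  subsemigroup (@fcomp I) (ellis Phi).
Proof.
move=> PhiD p q Ep Eq s e e0; have e20 : 0 < e / 2 by rewrite divr_gt0.
have [f Phif fp] := Ep [seq (c.1, q c) | c <- s] _ e20.
have [d d0 dP] := @continuous_mdist_seq R _ X X s (fun c => iterz (f c.1)) q _
  (fun c => @iterz_continuous R X (f c.1)) e20.
have [g Phig gq] := Eq s d d0.
exists (fun i => f i + g i) => [|c cs]; first exact: PhiD.
rewrite iterzD; apply: (@mdist_midpoint _ _ _ (iterz (f c.1) (q c))).
  by rewrite metric_sym; exact: (fp (c.1, q c) (map_f _ cs)).
exact/dP/gq.
Qed.

Lemma ellis_id : Phi (fun=> 0) -> ellis Phi (fun c => c.2).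
Proof. by move=> Phi0 s e e0; exists (fun=> 0) => // c _; rewrite mdistxx. Qed.

(** Integer iterates commute with [pi], and agreement of images survives pointwise limits. *)
Lemma ellis_fiber (Y : system R) (pi : X -> Y) p i a b : factor_map pi ->
  ellis Phi p -> pi a = pi b -> pi (p (i, a)) = pi (p (i, b)).
Proof.
move=> hpi Ep ab; apply: mdist_eq0P => e e0; have [pic _ _] := hpi.
have e20 : 0 < e / 2 by rewrite divr_gt0.
have [d d0 dP] := @continuous_mdist_seq R _ X Y [:: a; b] (fun=> pi)
  (fun c => p (i, c)) _ (fun=> pic) e20.
have [f _ fP] := Ep [:: (i, a); (i, b)] d d0.
have piE : pi (iterz (f i) a) = pi (iterz (f i) b).
  by rewrite !factor_iterz// ab.
apply: (@mdist_midpoint _ _ _ (pi (iterz (f i) a))).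
  by rewrite metric_sym; apply: dP (fP (i, a) _); rewrite !inE eqxx.
by rewrite piE metric_sym; apply: dP (fP (i, b) _); rewrite !inE eqxx ?orbT.
Qed.

End Exponents.

(** Common source of the diagonal, coordinate, face and reflection operations on cubes. *)
Lemma ellis_reindex (I J : eqType) (Phi : set (I -> int)) (Psi : set (J -> int))
    (sigma : I -> J) (p : fiber_maps J) :
  (forall f, Psi f -> Phi (f \o sigma)) -> ellis Psi p ->
  ellis Phi (fun c => p (sigma c.1, c.2)).
Proof.
move=> PsiPhi Ep s e e0.
have [f Psif fp] := Ep [seq (sigma c.1, c.2) | c <- s] e e0.
exists (f \o sigma) => [|c cs]; first exact: PsiPhi.
exact: (fp (sigma c.1, c.2) (map_f (fun c => (sigma c.1, c.2)) cs)).
Qed.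

End EllisSet.

(** * Minimal ideals and recurrence *)

Section MinimalIdeals.
Variables (R : realType) (X : system R).

(** Turns approximate solutions at every scale into one limit: a cluster point of exponents that are
    good at scale [1/(k+1)]. *)
Lemma ellis_limit (I : eqType) (Phi : set (I -> int))
    (P : R -> (I -> int) -> Prop) :
  (forall d d' f, P d f -> d <= d' -> P d' f) ->
  (forall d, 0 < d -> exists2 f, Phi f & P d f) ->
  exists2 p : fiber_maps X I, ellis Phi p &
    forall (s : seq (I * X)) (e : R), 0 < e -> exists2 f, P e f &
      forall c, c \in s -> mdist (p c) (iterz (f c.1) c.2) < e.
Proof.
move=> Pmono Pex; have d0 k : 0 < k.+1%:R^-1 :> R by rewrite invr_gt0.
have /choice[g gP] : forall k, exists f, Phi f /\ P k.+1%:R^-1 f.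
  by move=> k; have [f Phif Pf] := Pex _ (d0 k); exists f.
have [p Ep pP] := @ellis_cluster R X I Phi g (fun k => (gP k).1).
exists p => // s e e0; have [k0 _ k0P] := near_infty_natSinv_lt (PosNum e0).
have [k k0k ks] := pP s e k0 e0; exists (g k) => //.
by apply: Pmono (gP k).2 _; exact/ltW/k0P.
Qed.

(** The enveloping semigroup of the system, as the case of one index. *)
Definition zellis : set (fiber_maps X unit) := ellis setT.

Lemma minimal_approx (x y : X) (e : R) : minimal_system X -> 0 < e ->
  exists m, mdist y (iterz m x) < e.
Proof.
move=> Xmin e0; have [||z [/interior_subset]] := Xmin x (ball y e)^°.
- by exists y; exact: nbhsx_ballx.
- exact: open_interior.
- by rewrite ballEmdist /= => yz [m _ mz]; exists m; rewrite mz.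
Qed.

Lemma zellis_transitive (x y : X) : minimal_system X ->
  exists2 q, zellis q & q (tt, x) = y.
Proof.
move=> Xmin; have [d d' f yf dd'|d d0|q Eq qP] := @ellis_limit unit setT
    (fun d f => mdist y (iterz (f tt) x) < d).
- exact: lt_le_trans dd'.
- by have [m ym] := minimal_approx x y Xmin d0; exists (fun=> m).
exists q => //; apply: mdist_eq0P => e e0; have e20 : 0 < e / 2 by rewrite divr_gt0.
have [f yf /(_ (tt, x))] := qP [:: (tt, x)] _ e20.
rewrite inE eqxx => /(_ isT) qf; apply: mdist_midpoint.
  by rewrite metric_sym; exact: qf.
by rewrite metric_sym.
Qed.

Definition minimal_left_ideal (L : set (fiber_maps X unit)) :=
  [/\ L `<=` zellis, closed L, left_ideal (@fcomp R X unit) zellis L &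
    forall p q, L p -> L q -> exists2 a, zellis a & fcomp a p = q].

Lemma exists_minimal_zideal : exists L, minimal_left_ideal L.
Proof.
apply: exists_minimal_left_ideal.
- exact: fiber_maps_hausdorff.
- exact: fcompA.
- exact: fcomp_continuous.
- exact: ellis_compact.
- exact: ellis_closed.
- by exists (fun c => c.2); exact: ellis_id.
- exact: ellis_subsemigroup.
Qed.

(** Ellis-Numakura applies to the elements of [L] fixing [x]. There is one: by minimality of the
    system some [q] carries [l x] back to [x], and [q l] stays in [L]. *)
Lemma idempotent_fixing (L : set (fiber_maps X unit)) (x : X) :
  minimal_system X -> minimal_left_ideal L ->
  exists u, [/\ L u, fcomp u u = u & u (tt, x) = x].
Proof.
move=> Xmin [LE Lcl [[l Ll] LH] Lmin].
pose K := L `&` [set p : fiber_maps X unit | p (tt, x) = x].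
have Kcl : closed K.
  apply: closedI => //.
  apply: ((continuous_closedP (fun p : fiber_maps X unit => p (tt, x))).1 _ [set x]).
    exact: (@proj_continuous _ (fun _ : unit * X => X : topologicalType)).
  exact/accessible_closed_set1/hausdorff_accessible/metric_hausdorff.
have [|p q [Lp px] [Lq qx]|u [Lu ux] uu] := ellis_numakura
  (@fiber_maps_hausdorff R X unit) (@fcompA R X unit) (@fcomp_continuous R X unit)
  (subclosed_compact Kcl (@fiber_maps_compact R X unit) (fun _ _ => Logic.I)) Kcl.
- have [q Eq qx] := zellis_transitive (l (tt, x)) x Xmin.
  by exists (fcomp q l); split; [exact: LH|].
- by split; [apply: LH => //; exact: LE|rewrite /= /fcomp qx].
- by exists u.
Qed.

(* Projecting the idempotent [v] to a coordinate gives an idempotent of the same minimal left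
   ideal as [u], hence one with [u v = u]. *)
Lemma minimal_point_return (I : eqType) (Phi : set (I -> int))
    (L : set (fiber_maps X unit)) u x p :
  (forall f g, Phi f -> Phi g -> Phi (fun i => f i + g i)) ->
  (forall m, Phi (fun=> m)) ->
  minimal_left_ideal L -> L u -> fcomp u u = u -> u (tt, x) = x ->
  ellis Phi p -> exists2 q, ellis Phi q & forall i, q (i, p (i, x)) = x.
Proof.
move=> PhiD Phic [LE Lcl [_ LH] Lmin] Lu uu ux Ep.
have Esg := @ellis_subsemigroup R X I Phi PhiD.
pose r : fiber_maps X I := fun c => u (tt, c.2).
have Er : ellis Phi r.
  by apply: (ellis_reindex (sigma := fun=> tt)) (LE _ Lu) => f _; exact: Phic.
have Epr : ellis Phi (fcomp p r) by exact: Esg.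
(* The left ideal generated by [p r] contains an idempotent [a p r], whose coordinate [i] is [w u]
   below. Since [w u] lies in [L], [u w u = u]; at [x] this says that [r a] undoes [p]. *)
pose K := (@fcomp R X I)^~ (fcomp p r) @` ellis Phi.
have Eco := @ellis_compact R X I Phi.
have [||||_ [a Ea <-] vv] := @ellis_numakura _ (@fcomp R X I)
  (@fiber_maps_hausdorff R X I) (@fcompA R X I) (@fcomp_continuous R X I) K.
- apply: continuous_compact => //; apply: continuous_subspaceT.
  exact: fcomp_continuous.
- apply: closed_op_image => //; [exact: fiber_maps_hausdorff|
    exact: fcomp_continuous|exact: ellis_closed].
- by exists (fcomp p (fcomp p r)), p.
- move=> _ _ [b Eb <-] [c Ec <-]; exists (fcomp (fcomp b (fcomp p r)) c) => //.
  by apply: (Esg) => //; exact: Esg.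
exists (fcomp r a) => [|i]; first exact: Esg.
pose w : fiber_maps X unit := fun c => a (i, p (i, c.2)).
have Ew : zellis w.
  by apply: (ellis_reindex (Psi := Phi) (sigma := fun=> i)) (Esg _ _ Ea Ep).
have wuwu : fcomp (fcomp w u) (fcomp w u) = fcomp w u.
  by apply/funext => -[[] y]; exact: (congr1 (fun g => g (i, y)) vv).
have uwu : fcomp u (fcomp w u) = u.
  exact: (idempotent_right_unit (@fcompA R X unit) Lmin Lu (LH _ _ Ew Lu) wuwu).
by have := congr1 (fun g => g (tt, x)) uwu; rewrite /fcomp /w /= ux.
Qed.

End MinimalIdeals.

(** * Cubes *)

Section Cube.
Implicit Types D : nat.

Definition vertex D := {ffun 'I_D -> bool}.

(** Exponents of the Host-Kra cube group, generated by the diagonal and face transformations. *)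
Definition affine D : set (vertex D -> int) :=
  [set f | exists m n, forall eps, f eps = m + cube_dot n eps].

Lemma affineD D f g : @affine D f -> @affine D g -> affine (fun eps => f eps + g eps).
Proof.
move=> [m [n fE]] [m' [n' gE]]; exists (m + m'), [ffun i => n i + n' i] => eps.
rewrite fE gE addrACA -big_split /=; congr (_ + _).
by apply: eq_bigr => i _; rewrite ffunE mulrDl.
Qed.

Lemma affine_const D m : @affine D (fun=> m).
Proof.
exists m, [ffun=> 0] => eps; rewrite /cube_dot big1 ?addr0// => i _.
by rewrite ffunE mul0r.
Qed.

(** Any function of one bit is affine over the integers: [g b = g 0 + b (g 1 - g 0)]. *)
Lemma affine_coordwise D (g : 'I_D -> bool -> bool) f : affine f ->
  affine (f \o fun eps : vertex D => [ffun i => g i (eps i)]).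
Proof.
move=> [m [n fE]]; exists (m + \sum_(i < D) n i * (g i false)%:R),
  [ffun i => n i * ((g i true)%:R - (g i false)%:R)] => eps.
rewrite /= fE -addrA -big_split /=; congr (_ + _); apply: eq_bigr => i _.
by rewrite !ffunE; case: (eps i); rewrite /= ?mulr0 ?addr0 ?mulr1// -mulrDr addrC subrK.
Qed.

Lemma affine_coordinate D (j : 'I_D) m : affine (fun eps => if eps j then m else 0).
Proof.
exists 0, [ffun i => if i == j then m else 0] => eps; rewrite add0r /cube_dot.
rewrite (bigD1 j)//= ffunE eqxx big1 => [|i /negPf ij].
  by case: (eps j); rewrite ?mulr1 ?mulr0 addr0.
by rewrite ffunE ij mul0r.
Qed.

Definition vertex_cons D b (eps : vertex D) : vertex D.+1 :=
  [ffun i => oapp eps b (unlift ord0 i)].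

Definition vertex_tail D (eps : vertex D.+1) : vertex D :=
  [ffun i => eps (lift ord0 i)].

(** The two faces in direction [ord0] share their linear part, as the translates of the two points
    in [RP] do. *)
Lemma affine_restrict D (f : vertex D.+1 -> int) : affine f ->
  exists n, forall b eps,
    f (vertex_cons b eps) = cube_dot n eps + f (vertex_cons b [ffun=> false]).
Proof.
move=> [m [n fE]]; exists [ffun i => n (lift ord0 i)] => b eps.
rewrite !fE addrCA; congr (_ + _); rewrite /cube_dot !big_ord_recl.
rewrite !ffunE unlift_none /= [X in _ = _ + (_ + X)]big1 ?addr0 => [|i _].
  by rewrite addrC; congr (_ + _); apply: eq_bigr => i _; rewrite !ffunE liftK.
by rewrite ffunE liftK /= ffunE mulr0.
Qed.

Lemma affine_extend D (n : {ffun 'I_D -> int}) m m' :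
  affine (fun eps => cube_dot n (vertex_tail eps) + if eps ord0 then m' else m).
Proof.
exists m, [ffun i => oapp n (m' - m) (unlift ord0 i)] => eps.
rewrite /cube_dot [in RHS]big_ord_recl ffunE unlift_none /= addrC addrA.
congr (_ + _); first by case: (eps ord0); rewrite ?mulr1 ?mulr0 ?addr0// addrC subrK.
by apply: eq_bigr => i _; rewrite !ffunE liftK.
Qed.

Definition face_proj D (j : 'I_D) (eps : vertex D) : vertex D :=
  [ffun i => (i != j) && eps i].

Definition reflect_cube D (S : pred 'I_D) (eps : vertex D) : vertex D :=
  [ffun i => S i (+) eps i].

Lemma face_proj_id D (j : 'I_D) (eps : vertex D) :
  eps j = false -> face_proj j eps = eps.
Proof. by move=> ej; apply/ffunP => i; rewrite ffunE; case: eqP => // ->. Qed.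

Lemma reflect_cubeK D (S : pred 'I_D) : involutive (reflect_cube S).
Proof. by move=> eps; apply/ffunP => i; rewrite !ffunE addbA addbb. Qed.

End Cube.

(** * Limits of cube transformations *)

Section CubeEllis.
Variables (R : realType) (X : system R) (D : nat).

Lemma ellis_diag (t : fiber_maps X unit) : zellis t ->
  ellis (@affine D) (fun c => t (tt, c.2)).
Proof.
apply: (ellis_reindex (I := vertex D) (sigma := fun=> tt)) => f _.
exact: affine_const.
Qed.

Lemma ellis_coord (p : fiber_maps X (vertex D)) (eps : vertex D) :
  ellis (@affine D) p -> zellis (fun c : unit * X => p (eps, c.2)).
Proof. exact: (ellis_reindex (I := unit) (sigma := fun=> eps)). Qed.

Lemma ellis_face_proj (p : fiber_maps X (vertex D)) (j : 'I_D) :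
  ellis (@affine D) p -> ellis (@affine D) (fun c => p (face_proj j c.1, c.2)).
Proof.
apply: (ellis_reindex (I := vertex D) (sigma := face_proj j)) => f.
exact: (@affine_coordwise D (fun i b => (i != j) && b)).
Qed.

Lemma ellis_reflect (p : fiber_maps X (vertex D)) (S : pred 'I_D) :
  ellis (@affine D) p -> ellis (@affine D) (fun c => p (reflect_cube S c.1, c.2)).
Proof.
apply: (ellis_reindex (I := vertex D) (sigma := reflect_cube S)) => f.
exact: (@affine_coordwise D (fun i b => S i (+) b)).
Qed.

Lemma ellis_comp (p q : fiber_maps X (vertex D)) :
  ellis (@affine D) p -> ellis (@affine D) q -> ellis (@affine D) (fcomp p q).
Proof. by apply: ellis_subsemigroup; exact: affineD. Qed.

(* Composing the actions of [v] along the [D] directions gives [v] off the origin, as [v v = v]. *)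
Lemma ellis_off_origin (v : fiber_maps X unit) : zellis v -> fcomp v v = v ->
  ellis (@affine D) (fun c => if c.1 == [ffun=> false] then c.2 else v (tt, c.2)).
Proof.
move=> Ev vv; have vvE y : v (tt, v (tt, y)) = v (tt, y).
  exact: (congr1 (fun g => g (tt, y)) vv).
have Ej j : ellis (@affine D)
    (fun c : vertex D * X => if c.1 j then v (tt, c.2) else c.2).
  move=> s e e0; have [f _ fv] := Ev [seq (tt, c.2) | c <- s] e e0.
  exists (fun eps : vertex D => if eps j then f tt else 0) => [|c cs].
    exact: affine_coordinate.
  case: (c.1 j) => /=; last by rewrite mdistxx.
  exact: (fv (tt, c.2) (map_f (fun c => (tt, c.2)) cs)).
have Es (s : seq 'I_D) : ellis (@affine D)
    (fun c : vertex D * X => if has c.1 s then v (tt, c.2) else c.2).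
  elim: s => [|j s IHs]; first by apply: ellis_id; exact: affine_const.
  rewrite (_ : (fun c => _) = fcomp (fun c : vertex D * X =>
      if c.1 j then v (tt, c.2) else c.2)
    (fun c : vertex D * X => if has c.1 s then v (tt, c.2) else c.2)).
    exact: ellis_comp.
  apply/funext => c; rewrite /fcomp /=.
  by case: (c.1 j) => //=; case: ifP.
have := Es (enum 'I_D); congr ellis; apply/funext => c.
have -> : has c.1 (enum 'I_D) = (c.1 != [ffun=> false]).
  apply/hasP/negP => [[i _ ci] /eqP c0|c0]; first by rewrite c0 ffunE in ci.
  apply: contrapT => nc; apply: c0; apply/eqP/ffunP => i; rewrite ffunE.
  by apply/negP => ci; apply: nc; exists i => //; rewrite mem_enum.
by case: eqP.
Qed.

End CubeEllis.

(** The base points of the two faces in direction [ord0] approximate [a] and [b]; at any other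
    vertex both faces approximate [b], hence each other. *)
Lemma ellis_RP (R : realType) (X : system R) d (p : fiber_maps X (vertex d.+1))
    (x a b : X) :
  ellis (@affine d.+1) p -> p ([ffun=> false], x) = a ->
  (forall eps, eps != [ffun=> false] -> p (eps, x) = b) -> RP d X (a, b).
Proof.
move=> Ep pa pb delta d0; have d20 : 0 < delta / 2 by rewrite divr_gt0.
have [f /affine_restrict[n fE] fP] :=
  Ep [seq (eps, x) | eps <- enum {: vertex d.+1}] _ d20.
have {}fP eps : mdist (p (eps, x)) (iterz (f eps) x) < delta / 2.
  by apply: (fP (eps, x)); apply: map_f; rewrite mem_enum.
have half_lt : delta / 2 < delta by rewrite ltr_pdivrMr// ltr_pMr// ltr1n.
have cons0 b' (eps : vertex d) : b' || (eps != [ffun=> false]) ->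
    vertex_cons b' eps != [ffun=> false].
  apply: contraL => /eqP/ffunP c0; rewrite negb_or negbK; apply/andP; split.
    by have := c0 ord0; rewrite !ffunE unlift_none /= => ->.
  by apply/eqP/ffunP => i; have := c0 (lift ord0 i); rewrite !ffunE liftK.
have cons00 : vertex_cons false [ffun=> false] = [ffun=> false] :> vertex d.+1.
  by apply/ffunP => i; rewrite !ffunE; case: unliftP => //= k _; rewrite ffunE.
exists (iterz (f (vertex_cons false [ffun=> false])) x),
  (iterz (f (vertex_cons true [ffun=> false])) x), n; split => /=.
- by rewrite -pa cons00; exact: lt_trans (fP _) half_lt.
- by rewrite -(pb (vertex_cons true [ffun=> false])) ?cons0//; exact: lt_trans (fP _) half_lt.
move=> eps eps0; rewrite -!iterzD -!fE.
have fb b' : mdist b (iterz (f (vertex_cons b' eps)) x) < delta / 2.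
  by rewrite -(pb (vertex_cons b' eps)) ?cons0 ?eps0 ?orbT.
exact: mdist_midpoint (fb false) (fb true).
Qed.

Lemma RP_sym (R : realType) (X : system R) d (x y : X) :
  RP d X (x, y) -> RP d X (y, x).
Proof.
move=> xy delta /xy[x' [y' [n [xx' yy' nP]]]]; exists y', x', n; split=> //.
by move=> eps /nP; rewrite metric_sym.
Qed.

(** * Lifting regionally proximal pairs *)

Lemma mdist_third (R : realType) (U : metricType R) (a b c d : U) (e : R) :
  mdist a b < e / 3 -> mdist b c < e / 3 -> mdist c d < e / 3 -> mdist a d < e.
Proof.
move=> ab bc cd; have := metric_triangle a b d; have := metric_triangle b c d.
by lra.
Qed.

Lemma compact_uniform_mdist (R : realType) (U V : metricType R) (f : U -> V)
    (e : R) : compact [set: U] -> continuous f -> 0 < e ->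
  exists2 d : R, 0 < d & forall x y, mdist x y < d -> mdist (f x) (f y) < e.
Proof.
move=> /compact_near_coveringP Uco fc e0; have e20 : 0 < e / 2 by rewrite divr_gt0.
pose P d x := forall y : U, mdist x y < d -> mdist (f x) (f y) < e.
have [x _|d /= d0 dP] := Uco R (0^'+)%R P _; last first.
  have d20 : 0 < d / 2 by rewrite divr_gt0.
  have half_lt : d / 2 < d by rewrite ltr_pdivrMr// ltr_pMr// ltr1n.
  exists (d / 2) => // x; apply: (dP (d / 2)) => //.
  by rewrite /= sub0r normrN gtr0_norm.
have [d d0 dP] := continuous_mdist (fc x) e20.
have d20 : 0 < d / 2 by rewrite divr_gt0.
exists (ball x (d / 2), [set r | r < d / 2]).
  by split; [exact: nbhsx_ballx|exact: nbhs_right_lt].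
move=> [z r] [/= + rd] y zy; rewrite ballEmdist /= => xz.
have xz' : mdist x z < d by apply: lt_trans xz _; rewrite ltr_pdivrMr// ltr_pMr// ltr1n.
apply: (@mdist_midpoint _ _ _ (f x)); apply: dP => //.
rewrite (splitr d); apply: le_lt_trans (metric_triangle x z y) _.
by rewrite ltrD// (lt_trans zy).
Qed.

(** The translated points vary with [delta], so the uniform continuity of [pi] is used. *)
Lemma factor_RP (R : realType) (X Y : system R) (pi : X -> Y) d (p : X * X) :
  factor_map pi -> RP d X p -> RP d Y (map_prod pi p).
Proof.
move=> hpi Xp e e0; have [pic _ _] := hpi.
have [d1 d10 dP] := compact_uniform_mdist (@space_compact R X) pic e0.
have [x' [y' [n [xx' yy' nP]]]] := Xp d1 d10.
exists (pi x'), (pi y'), n; split => /=; [exact: dP|exact: dP|].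
by move=> eps /nP xy; rewrite -!factor_iterz//; exact: dP.
Qed.

Definition vertex_unit d : vertex d.+1 := [ffun i => i == ord0].

(** By minimality, translates of the single point [x] approximate lifts of both witnesses of [RP].
    Their common [n] makes the two faces agree in [Y] away from their base vertices. *)
Lemma RP_ellis (R : realType) (X Y : system R) (pi : X -> Y) d (x : X)
    (y1 y2 : Y) : factor_map pi -> minimal_system X -> RP d Y (y1, y2) ->
  exists p : fiber_maps X (vertex d.+1), [/\ ellis (@affine d.+1) p,
    pi (p ([ffun=> false], x)) = y1, pi (p (vertex_unit d, x)) = y2 &
    forall eps, face_proj ord0 eps != [ffun=> false] ->
      pi (p (eps, x)) = pi (p (face_proj ord0 eps, x))].
Proof.
move=> hpi Xmin y12; have [pic pis _] := hpi.
pose P (e : R) (f : vertex d.+1 -> int) :=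
  [/\ mdist y1 (pi (iterz (f [ffun=> false]) x)) < e,
      mdist y2 (pi (iterz (f (vertex_unit d)) x)) < e &
      forall eps, face_proj ord0 eps != [ffun=> false] ->
        mdist (pi (iterz (f eps) x)) (pi (iterz (f (face_proj ord0 eps)) x)) < e].
have [e e' f [P1 P2 P3] ee'|e e0|p Ep pP] :=
    @ellis_limit R X (vertex d.+1) (@affine d.+1) P.
- by split=> [||eps /P3 Pe]; [exact: lt_le_trans ee'|exact: lt_le_trans ee'|
    exact: lt_le_trans Pe ee'].
- have e30 : 0 < e / 3 by rewrite divr_gt0.
  have [y1' [y2' [n [y1y1' y2y2' nP]]]] := y12 _ e30.
  pose h (a : vertex d) (z : X) := iterz (cube_dot n a) (pi z).
  have hc a : continuous (h a).
    move=> z; apply: continuous_comp; [exact: pic|exact: iterz_continuous].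
  (* One [m] serves all vertices, since only finitely many continuous maps [h a] are involved. *)
  have approx y' : exists m, forall a,
      mdist (iterz (cube_dot n a) y') (h a (iterz m x)) < e / 3.
    have [x' _ <-] := pis y' Logic.I.
    have [r r0 rP] := @continuous_mdist_seq R _ X Y (enum {: vertex d}) h
      (fun=> x') _ hc e30.
    have [m mr] := minimal_approx x x' Xmin r0; exists m => a.
    by apply: rP mr; rewrite mem_enum.
  have [m1 m1P] := approx y1'; have [m2 m2P] := approx y2'.
  exists (fun eps => cube_dot n (vertex_tail eps) + if eps ord0 then m2 else m1).
    exact: affine_extend.
  have cd0 : cube_dot n [ffun=> false] = 0.
    by rewrite /cube_dot big1// => i _; rewrite ffunE mulr0.
  have t0 : vertex_tail [ffun=> false] = [ffun=> false] :> vertex d.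
    by apply/ffunP => i; rewrite !ffunE.
  have tu : vertex_tail (vertex_unit d) = [ffun=> false] :> vertex d.
    by apply/ffunP => i; rewrite !ffunE.
  split.
  + rewrite t0 cd0 add0r ffunE; have := m1P [ffun=> false]; rewrite /h cd0 /=.
    move: y1y1' => /=.
    have := metric_triangle y1 y1' (pi (iterz m1 x)); lra.
  + rewrite tu cd0 add0r ffunE eqxx; have := m2P [ffun=> false]; rewrite /h cd0 /=.
    move: y2y2' => /=.
    have := metric_triangle y2 y2' (pi (iterz m2 x)); lra.
  + move=> eps eps0; have [epsT|epsF] := boolP (eps ord0); last first.
      by rewrite (face_proj_id (negbTE epsF)) (negbTE epsF) mdistxx.
    have tproj : vertex_tail (face_proj ord0 eps) = vertex_tail eps.
      by apply/ffunP => i; rewrite !ffunE.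
    have teps0 : vertex_tail eps != [ffun=> false].
      apply: contra eps0 => /eqP/ffunP tE; apply/eqP/ffunP => i.
      rewrite !ffunE; case: (unliftP ord0 i) => [k ->|->]; last by rewrite eqxx.
      by have := tE k; rewrite !ffunE.
    rewrite tproj [face_proj _ _ _]ffunE eqxx !iterzD !(factor_iterz (cube_dot _ _) _ hpi).
    apply: (mdist_third _ _ (m1P (vertex_tail eps))).
      by rewrite metric_sym; exact: m2P.
    by rewrite metric_sym; exact: nP.
have piP (e : R) : 0 < e -> exists2 f, P e f & forall eps : vertex d.+1,
    mdist (pi (p (eps, x))) (pi (iterz (f eps) x)) < e.
  move=> e0; have [r r0 rP] := @continuous_mdist_seq R _ X Y
    (enum {: vertex d.+1}) (fun=> pi) (fun eps => p (eps, x)) _ (fun=> pic) e0.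
  have re0 : 0 < Num.min r e by rewrite lt_min r0.
  have [f [P1 P2 P3] fP] := pP [seq (eps, x) | eps <- enum {: vertex d.+1}] _ re0.
  have rle : Num.min r e <= e by rewrite ge_min lexx orbT.
  exists f => [|eps].
    by split=> [||eps /P3 Pe]; [exact: lt_le_trans rle|exact: lt_le_trans rle|
      exact: lt_le_trans Pe rle].
  apply: rP; first by rewrite mem_enum.
  have : mdist (p (eps, x)) (iterz (f eps) x) < Num.min r e.
    by apply: (fP (eps, x)); apply: map_f; rewrite mem_enum.
  by rewrite lt_min => /andP[].
exists p; split=> // [||eps eps0]; apply: mdist_eq0P => e e0.
- have e20 : 0 < e / 2 by rewrite divr_gt0.
  have [f [P1 _ _] fP] := piP _ e20.
  by apply: (mdist_midpoint (y := pi (iterz (f [ffun=> false]) x)));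
    rewrite metric_sym.
- have e20 : 0 < e / 2 by rewrite divr_gt0.
  have [f [_ P2 _] fP] := piP _ e20.
  by apply: (mdist_midpoint (y := pi (iterz (f (vertex_unit d)) x)));
    rewrite metric_sym.
- have e30 : 0 < e / 3 by rewrite divr_gt0.
  have [f [_ _ P3] fP] := piP _ e30.
  by apply: mdist_third (fP eps) (P3 _ eps0) _; rewrite metric_sym.
Qed.

(* One direction [j] at a time: an element returning the face [eps j = 0] to the diagonal is
   also applied, in parallel, to the face [eps j = 1]. *)
Lemma straighten_cube (R : realType) (X Y : system R) (pi : X -> Y) D (x : X)
    (Om : X -> X -> Prop) (p : fiber_maps X (vertex D)) :
  factor_map pi ->
  (forall q, ellis (@affine D) q ->
    exists2 r, ellis (@affine D) r & forall eps, r (eps, q (eps, x)) = x) ->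
  (forall a a' b, pi a = pi a' -> Om a b -> Om a' b) ->
  (forall t a b, zellis t -> Om a b -> Om (t (tt, a)) (t (tt, b))) ->
  ellis (@affine D) p ->
  (forall eps, eps != [ffun=> true] -> pi (p (eps, x)) = pi x) ->
  Om x (p ([ffun=> true], x)) ->
  exists q, [/\ ellis (@affine D) q,
    forall eps, eps != [ffun=> true] -> q (eps, x) = x &
    Om x (q ([ffun=> true], x))].
Proof.
move=> hpi ret OmL OmT Ep pix Omp.
(* Induction on the list of treated directions: vertices with a zero coordinate in one of them
   already have value exactly [x]. *)
suff [q [Eq qs qpi Omq]] : exists q, [/\ ellis (@affine D) q,
    forall eps : vertex D, has (fun i => ~~ eps i) (enum 'I_D) -> q (eps, x) = x,
    forall eps, eps != [ffun=> true] -> pi (q (eps, x)) = pi x &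
    Om x (q ([ffun=> true], x))].
  exists q; split=> // eps eps1; apply: qs; apply/hasP; apply: contrapT => nh.
  move/eqP: eps1; apply; apply/ffunP => i; rewrite ffunE; apply: contrapT => /negP ei.
  by apply: nh; exists i; rewrite ?mem_enum.
elim: (enum 'I_D) => [|j s [q [Eq qs qpi Omq]]]; first by exists p.
have [r Er rP] := ret q Eq.
exists (fcomp (fun c => r (face_proj j c.1, c.2)) q).
have proj1 eps : face_proj j eps != [ffun=> true].
  by apply/eqP => /ffunP/(_ j); rewrite !ffunE eqxx.
have rP0 eps : r (eps, q (eps, x)) = x := rP eps.
(* Vertices straightened earlier are left undisturbed. *)
have {}rP eps : q (face_proj j eps, x) = x -> r (face_proj j eps, x) = x.
  by move=> qx; rewrite -{2}(rP0 (face_proj j eps)) qx.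
split.
- by apply: ellis_comp => //; exact: ellis_face_proj.
- move=> eps; rewrite /fcomp /= => /orP[/negbTE ej|eps_s].
    by rewrite face_proj_id.
  rewrite qs//; apply/rP/qs; case/hasP: eps_s => i si ei.
  by apply/hasP; exists i; rewrite // ffunE (negbTE ei) andbF.
- move=> eps eps1; rewrite /fcomp /= -[in RHS](rP0 (face_proj j eps)).
  by apply: (ellis_fiber _ hpi Er); rewrite !qpi.
(* One coordinate of [r] moves the last vertex and its projection together; the projection lies
   above [pi x] and is sent to [x]. *)
- rewrite /fcomp /= -[X in Om X _](rP0 (face_proj j [ffun=> true])).
  apply: (OmT (fun c => r (face_proj j [ffun=> true], c.2))).
    exact: ellis_coord.
  by apply: OmL Omq; rewrite qpi.
Qed.

Lemma RP_lift (R : realType) (X Y : system R) (pi : X -> Y) d (y1 y2 : Y) :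
  factor_map pi -> minimal_system X -> RP d Y (y1, y2) ->
  exists x1 x2, [/\ RP d X (x1, x2), pi x1 = y1 & pi x2 = y2].
Proof.
move=> hpi Xmin y12; have [_ pis _] := hpi.
have [b1 _ b1y] := pis y1 Logic.I; have [b2 _ b2y] := pis y2 Logic.I.
have [L Lmin] := exists_minimal_zideal X.
have [u [Lu uu ub1]] := idempotent_fixing b1 Xmin Lmin.
have [v [Lv vv vb2]] := idempotent_fixing b2 Xmin Lmin.
have [LE _ [_ LH] Ltrans] := Lmin.
have fib (t : fiber_maps X unit) a b : zellis t -> pi a = pi b ->
    pi (t (tt, a)) = pi (t (tt, b)).
  by move=> Et; exact: (ellis_fiber _ hpi Et).
(* The same [u] fixes [c] and [b1], so [(c, b1)] is a minimal point of the product system;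
   [(b1, b2)] need not be. *)
pose c := u (tt, b2).
have uc : u (tt, c) = c by exact: (congr1 (fun g => g (tt, b2)) uu).
have ret (q : fiber_maps X (vertex d.+1)) : ellis (@affine d.+1) q ->
    exists2 r, ellis (@affine d.+1) r & forall eps, r (eps, q (eps, c)) = c.
  apply: minimal_point_return Lmin Lu uu uc; [exact: affineD|exact: affine_const].
(* [Om a b] places [(pi a, pi b)] in the orbit closure of [(pi c, y1)]. *)
pose Om a b := exists s, [/\ zellis s, pi a = pi (s (tt, c)) & pi b = pi (s (tt, b1))].
have OmL a a' b : pi a = pi a' -> Om a b -> Om a' b.
  by move=> aa' [s [Es sa sb]]; exists s; rewrite -aa'.
have OmT t a b : zellis t -> Om a b -> Om (t (tt, a)) (t (tt, b)).
  move=> Et [s [Es sa sb]]; exists (fcomp t s); split.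
  - exact: ellis_subsemigroup.
  - exact: fib.
  - exact: fib.
have [p [Ep p0 pe pproj]] := RP_ellis c hpi Xmin (RP_sym y12).
(* Applying [u] puts the origin above [pi c] and keeps [vertex_unit d] above [y1]. *)
pose p1 : fiber_maps X (vertex d.+1) := fcomp (fun c => u (tt, c.2)) p.
have Ep1 : ellis (@affine d.+1) p1.
  by apply: ellis_comp => //; apply: ellis_diag; exact: LE.
have [q Eq qp1] := ret p1 Ep1.
(* The return of the face at the origin is applied to both faces in direction [ord0]; then only
   [vertex_unit d] may leave the fiber of [c]. *)
pose p2 : fiber_maps X (vertex d.+1) :=
  fcomp (fun c => q (face_proj ord0 c.1, c.2)) p1.
have Ep2 : ellis (@affine d.+1) p2.
  by apply: ellis_comp => //; exact: ellis_face_proj.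
have p2c eps : eps != vertex_unit d -> pi (p2 (eps, c)) = pi c.
  move=> eps1; rewrite -[in RHS](qp1 (face_proj ord0 eps)).
  apply: (ellis_fiber _ hpi Eq); apply: fib; first exact: LE.
  have [epsT|/negbTE/face_proj_id->//] := boolP (eps ord0).
  apply: pproj; apply: contra eps1 => /eqP/ffunP eps0; apply/eqP/ffunP => i.
  by have := eps0 i; rewrite !ffunE; case: eqP => [->|].
have proj_unit : face_proj ord0 (vertex_unit d) = [ffun=> false].
  by apply/ffunP => i; rewrite !ffunE; case: eqP.
have Om2 : Om c (p2 (vertex_unit d, c)).
  rewrite /p2 /fcomp /= proj_unit -[X in Om X _](qp1 [ffun=> false]).
  apply: (OmT (fun c => q ([ffun=> false], c.2))); first exact: ellis_coord.
  exists (fun c => c.2); split; first exact: ellis_id.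
    by apply: (fib u _ b2 (LE _ Lu)); rewrite p0 b2y.
  by rewrite /= -[in RHS]ub1; apply: (fib u _ b1 (LE _ Lu)); rewrite pe b1y.
(* Reflecting every direction but [ord0] moves the exceptional vertex to the all-ones vertex, as
   [straighten_cube] requires. *)
pose p3 : fiber_maps X (vertex d.+1) :=
  fun c => p2 (reflect_cube (predC1 ord0) c.1, c.2).
have reflect1 : reflect_cube (predC1 ord0) [ffun=> true] = vertex_unit d.
  by apply/ffunP => i; rewrite !ffunE /= addbT negbK.
have [p4 [Ep4 p4c Om4]] : exists p4, [/\ ellis (@affine d.+1) p4,
    forall eps, eps != [ffun=> true] -> p4 (eps, c) = c &
    Om c (p4 ([ffun=> true], c))].
  apply: (straighten_cube (p := p3)) hpi ret OmL OmT _ _ _.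
  - exact: ellis_reflect.
  - move=> eps eps1; apply: p2c; apply: contra eps1 => /eqP eps1.
    by rewrite -(reflect_cubeK (predC1 ord0) eps) /= eps1 -reflect1 reflect_cubeK.
  - by rewrite /p3 /= reflect1.
have [s [Es cs zs]] := Om4.
(* As [s u] lies in [L], some [t] gives [t s u = u], so [t] undoes [s] at both [c] and [b1]. *)
have [t Et tsu] := Ltrans _ _ (LH _ _ Es Lu) Lu.
have tsuE y : t (tt, s (tt, u (tt, y))) = u (tt, y).
  exact: (congr1 (fun g => g (tt, y)) tsu).
have vuE y : v (tt, u (tt, y)) = v (tt, y).
  have vu := idempotent_right_unit (@fcompA R X unit) Ltrans Lv Lu uu.
  exact: (congr1 (fun g => g (tt, y)) vu).
(* Reflecting all directions brings the exceptional vertex to the origin. *)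
pose p5 : fiber_maps X (vertex d.+1) :=
  fcomp (fun c => t (tt, c.2)) (fun c => p4 (reflect_cube predT c.1, c.2)).
have Ep5 : ellis (@affine d.+1) p5.
  by apply: ellis_comp; [exact: ellis_diag|exact: ellis_reflect].
have Ep6 := ellis_comp (ellis_off_origin (LE _ Lv) vv) Ep5.
exists (t (tt, p4 ([ffun=> true], c))), (v (tt, t (tt, c))); split.
- apply: ellis_RP Ep6 _ _; rewrite /fcomp /= ?eqxx /p5 /fcomp /=.
    by congr (t (tt, p4 (_, c))); apply/ffunP => i; rewrite !ffunE.
  move=> eps eps0; rewrite (negbTE eps0) p4c//; apply: contra eps0 => /eqP eps1.
  rewrite -(reflect_cubeK predT eps) /= eps1; apply/eqP/ffunP => i.
  by rewrite !ffunE.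
- rewrite -b1y (fib _ _ _ Et zs) -[in RHS]ub1 -[in RHS]tsuE.
  by rewrite ub1.
(* Above [Y], [t c] agrees with [t s c = u b2], and [v u b2 = v b2 = b2]. *)
- rewrite -b2y -[in RHS]vb2 -vuE; apply: (fib v _ _ (LE _ Lv)).
  by rewrite (fib _ _ _ Et cs) tsuE.
Qed.

Theorem theorem3p8 (R : realType) (X Y : system R) (pi : X -> Y) (d : nat)
    (hpi : factor_map pi) (hd : (1 <= d)%N) :
  (map_prod pi @` RP d X `<=` RP d Y) /\
  (minimal_system X -> map_prod pi @` RP d X = RP d Y).
Proof.
have sub : map_prod pi @` RP d X `<=` RP d Y by move=> _ [p Xp <-]; exact: factor_RP.
split=> // Xmin; apply/seteqP; split=> // -[y1 y2] y12.
have [x1 [x2 [x12 <- <-]]] := RP_lift hpi Xmin y12.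
by exists (x1, x2).
Qed.
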